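(* Let $(\mathcal{M},d)$ be a metric space with a distinguished base point $0\in\mathcal{M}$, and let $0<p<1$. Then the Banach envelope map $J_p[\mathcal{M}]\colon \mathcal{F}_p(\mathcal{M})\to\mathcal{F}(\mathcal{M})$ of the Lipschitz-free $p$-space $\mathcal{F}_p(\mathcal{M})$, that is, the unique bounded linear operator satisfying $J_p[\mathcal{M}](\delta_{p,\mathcal{M}}(x))=\delta_{1,\mathcal{M}}(x)$ for all $x\in\mathcal{M}$, is one-to-one.
   Context: All vector spaces are real. For $0<p\le 1$, a $p$-norm on a vector space $X$ is a map $\|\cdot\|\colon X\to[0,\infty)$ with $\|x\|=0$ only if $x=0$, $\|tx\|=|t|\,\|x\|$ for all scalars $t$, and $\|x+y\|^p\le\|x\|^p+\|y\|^p$. A $p$-normed space is a vector space equipped with a $p$-norm, and a $p$-Banach space is a $p$-normed space that is complete for the metric $(x,y)\mapsto\|x-y\|^p$. Lipschitz-free $p$-spaces. Let $(\mathcal{M},d)$ be a metric space with base point $0$ and let $0<p\le 1$. Let $\mathbb{R}_0^{\mathcal{M}}$ be the vector space of all functions $f\colon\mathcal{M}\to\mathbb{R}$ with $f(0)=0$. For $x\in\mathcal{M}$ let $\delta_{\mathcal{M}}(x)$ be the element of the algebraic dual of $\mathbb{R}_0^{\mathcal{M}}$ given by $\langle\delta_{\mathcal{M}}(x),f\rangle=f(x)$; note that $\delta_{\mathcal{M}}(0)=0$. Let $\mathcal{P}(\mathcal{M})$ be the linear span of $\{\delta_{\mathcal{M}}(x):x\in\mathcal{M}\}$. For $\mu=\sum_{x\in\mathcal{M}}a_x\delta_{\mathcal{M}}(x)\in\mathcal{P}(\mathcal{M})$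 (finitely many nonzero $a_x$) put $$\|\mu\|_{\mathcal{F}_p(\mathcal{M})}=\sup\Big\|\sum_{x\in\mathcal{M}}a_xf(x)\Big\|_X,$$ the supremum being taken over all $p$-normed spaces $(X,\|\cdot\|_X)$ and all $1$-Lipschitz maps $f\colon\mathcal{M}\to X$ with $f(0)=0$. It is known that this is a $p$-norm on $\mathcal{P}(\mathcal{M})$ and that $$\|\mu\|_{\mathcal{F}_p(\mathcal{M})}=\inf\Big(\sum_{j\in F}|a_j|^p\Big)^{1/p},$$ the infimum being taken over all finite families $(a_j)_{j\in F}$ in $\mathbb{R}$ for which there are $x_j\ne y_j$ in $\mathcal{M}$ ($j\in F$) with $\mu=\sum_{j\in F}a_j\frac{\delta_{\mathcal{M}}(x_j)-\delta_{\mathcal{M}}(y_j)}{d(x_j,y_j)}$. The Lipschitz-free $p$-space $\mathcal{F}_p(\mathcal{M})$ is the completion of $(\mathcal{P}(\mathcal{M}),\|\cdot\|_{\mathcal{F}_p(\mathcal{M})})$; it is a $p$-Banach space. The map $\delta_{p,\mathcal{M}}\colon\mathcal{M}\to\mathcal{F}_p(\mathcal{M})$ is $\delta_{\mathcal{M}}$ regarded as a map into $\mathcal{F}_p(\mathcal{M})\supseteq\mathcal{P}(\mathcal{M})$; it is an isometric embedding. For every $p$-Banach space $X$, every Lipschitz map $f\colon\mathcal{M}\to X$ with $f(0)=0$ has a unique bounded linear extension $E[f;p]\colon\mathcal{F}_p(\mathcal{M})\to X$ with $E[f;p]\circ\delta_{p,\mathcal{M}}=f$, and $\|E[f;p]\|=\mathrm{Lip}(f)$.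 Write $\mathcal{F}(\mathcal{M})=\mathcal{F}_1(\mathcal{M})$ (the usual Lipschitz-free Banach space, or Arens--Eells space). The envelope map is $J_p[\mathcal{M}]=E[\delta_{1,\mathcal{M}};p]\colon\mathcal{F}_p(\mathcal{M})\to\mathcal{F}(\mathcal{M})$. Banach envelopes. The Banach envelope of a quasi-Banach space $X$ is a Banach space $\widehat X$ together with a linear contraction $J_X\colon X\to\widehat X$ (the envelope map) such that for every Banach space $Y$ and every continuous linear $T\colon X\to Y$ there is a unique continuous linear $\widehat T\colon\widehat X\to Y$ with $\widehat T\circ J_X=T$, and $\|\widehat T\|\le\|T\|$. It is known that for a metric space $\mathcal{M}$ the Banach envelope of $\mathcal{F}_p(\mathcal{M})$ is $(\mathcal{F}(\mathcal{M}),J_p[\mathcal{M}])$. *)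

(* Defs.v *)
From HB Require Import structures.
From mathcomp Require Import all_boot all_order all_algebra.
From mathcomp Require Import all_classical all_reals all_analysis.
From mathcomp Require Import generic_quotient ring_quotient lra.

Set Implicit Arguments.
Unset Strict Implicit.
Unset Printing Implicit Defensive.
Import Order.TTheory GRing.Theory Num.Theory numFieldNormedType.Exports.
Local Open Scope classical_set_scope.
Local Open Scope ring_scope.

Record exponent (R : realType) := Exponent {
  expo :> R;
  expo_gt0 : 0 < expo;
  expo_le1 : expo <= 1 }.

Definition exponent1 (R : realType) : exponent R :=
  @Exponent R 1 ltr01 (lexx 1).

HB.mixin Record Lmodule_isPNormed (R : realType) (p : exponent R) V
    of GRing.Lmodule R V := {
  pnorm : V -> R;
  pnorm_ge0 : forall x, 0 <= pnorm x;
  pnorm_eq0 : forall x, pnorm x = 0 -> x = 0;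
  pnormZ : forall t x, pnorm (t *: x) = `|t| * pnorm x;
  pnorm_triangle : forall x y,
    pnorm (x + y) `^ p <= pnorm x `^ p + pnorm y `^ p }.

#[short(type="pNormedType")]
HB.structure Definition PNormed (R : realType) (p : exponent R) :=
  { V of GRing.Lmodule R V & Lmodule_isPNormed R p V }.

Definition pdist (R : realType) (p : exponent R) (X : pNormedType p)
  (x y : X) : R := pnorm (x - y) `^ p.

Definition p_cauchy (R : realType) (p : exponent R) (X : pNormedType p)
    (u : nat -> X) : Prop :=
  forall e : R, 0 < e -> exists N, forall m n,
    (N <= m)%N -> (N <= n)%N -> pdist (u m) (u n) < e.

Definition p_converges (R : realType) (p : exponent R) (X : pNormedType p)
    (u : nat -> X) (l : X) : Prop :=
  forall e : R, 0 < e -> exists N, forall n, (N <= n)%N -> pdist (u n) l < e.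

HB.mixin Record PNormed_isComplete (R : realType) (p : exponent R) V
    of PNormed R p V := {
  p_complete : forall u : nat -> V, p_cauchy u -> exists l, p_converges u l }.

#[short(type="pBanachType")]
HB.structure Definition PBanach (R : realType) (p : exponent R) :=
  { V of PNormed R p V & PNormed_isComplete R p V }.

Definition bounded_linear (R : realType) (p q : exponent R)
    (X : pNormedType p) (Y : pNormedType q) (T : X -> Y) : Prop :=
  linear T /\ exists C : R, forall x, pnorm (T x) <= C * pnorm x.

Section PNormedTheory.
Variables (R : realType) (p : exponent R).

Lemma expo_ge0 : 0 <= (p : R). Proof. exact: ltW (expo_gt0 p). Qed.

Lemma expo_neq0 : (p : R) != 0. Proof. by rewrite gt_eqF// expo_gt0. Qed.

Lemma powR_expoK (a : R) : 0 <= a -> (a `^ p) `^ (p : R)^-1 = a.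
Proof. by move=> a0; rewrite -powRrM mulfV ?expo_neq0// powRr1. Qed.

Lemma powR_expoVK (a : R) : 0 <= a -> (a `^ (p : R)^-1) `^ p = a.
Proof. by move=> a0; rewrite -powRrM mulVf ?expo_neq0// powRr1. Qed.

Lemma ler_powR_expo (a b : R) : 0 <= a -> a <= b -> a `^ p <= b `^ p.
Proof.
move=> a0 ab; apply: ge0_ler_powR => //; rewrite ?nnegrE ?expo_ge0//.
exact: le_trans ab.
Qed.

Lemma powR_subadd (a b : R) :
  0 <= a -> 0 <= b -> (a + b) `^ p <= a `^ p + b `^ p.
Proof.
move=> a0 b0; have [ab0|] := eqVneq (a + b) 0.
  by rewrite ab0 powR0 ?expo_neq0// addr_ge0// powR_ge0.
rewrite neq_lt ltNge addr_ge0//= => ab0.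
have key c : 0 <= c -> c <= a + b -> c / (a + b) * (a + b) `^ p <= c `^ p.
  move=> c0 cab; have [->|cN0] := eqVneq c 0.
    by rewrite !mul0r powR_ge0.
  have c_gt0 : 0 < c by rewrite lt_neqAle eq_sym cN0.
  rewrite -{2}[c](divfK (lt0r_neq0 ab0)) [in leRHS]powRM ?divr_ge0 ?(ltW ab0)//.
  rewrite ler_wpM2r ?powR_ge0// ger1_powR ?expo_le1//.
  by rewrite divr_gt0//= ler_pdivrMr// mul1r.
rewrite -[leLHS]mul1r -[X in X * _](divff (lt0r_neq0 ab0)) mulrDl mulrDl.
by rewrite lerD// key// (lerDl, lerDr).
Qed.

Section Space.
Variable X : pNormedType p.
Implicit Types x y z : X.

Lemma pnorm0 : pnorm (0 : X) = 0.
Proof. by rewrite -(scale0r (0 : X)) pnormZ normr0 mul0r. Qed.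

Lemma pnormN x : pnorm (- x) = pnorm x.
Proof. by rewrite -scaleN1r pnormZ normrN1 mul1r. Qed.

Lemma pnorm_powZ t x : pnorm (t *: x) `^ p = `|t| `^ p * pnorm x `^ p.
Proof. by rewrite pnormZ powRM ?pnorm_ge0. Qed.

Lemma pdistxx x : pdist x x = 0.
Proof. by rewrite /pdist subrr pnorm0 powR0// expo_neq0. Qed.

Lemma pdist_ge0 x y : 0 <= pdist x y. Proof. exact: powR_ge0. Qed.

Lemma pdistC x y : pdist x y = pdist y x.
Proof. by rewrite /pdist -pnormN opprB. Qed.

Lemma pdist_triangle y x z : pdist x z <= pdist x y + pdist y z.
Proof. by rewrite /pdist -(subrKA y) pnorm_triangle. Qed.

Lemma pdist_eq0 x y : pdist x y = 0 -> x = y.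
Proof. by move/powR_eq0_eq0/pnorm_eq0/eqP; rewrite subr_eq0 => /eqP. Qed.

Lemma pdistD x y x' y' : pdist (x + y) (x' + y') <= pdist x x' + pdist y y'.
Proof. by rewrite /pdist opprD addrACA pnorm_triangle. Qed.

Lemma pdistZ t x y : pdist (t *: x) (t *: y) = `|t| `^ p * pdist x y.
Proof. by rewrite /pdist -scalerBr pnorm_powZ. Qed.

Lemma pnorm_powE x : pnorm x `^ p = pdist x 0.
Proof. by rewrite /pdist subr0. Qed.

Lemma ler_dist_pnorm x y : `|pnorm x `^ p - pnorm y `^ p| <= pdist x y.
Proof.
rewrite !pnorm_powE ler_norml.
have := pdist_triangle x y 0; have := pdist_triangle y x 0.
by rewrite (pdistC y x) => *; apply/andP; split; lra.
Qed.

Lemma p_converges_unique (u : nat -> X) x y :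
  p_converges u x -> p_converges u y -> x = y.
Proof.
move=> ux uy; apply: pdist_eq0; apply/eqP; rewrite eq_le pdist_ge0 andbT.
apply/ler_addgt0Pl => e e0; rewrite addr0.
have [N1 h1] := ux _ (divr_gt0 e0 (ltr0n R 2)).
have [N2 h2] := uy _ (divr_gt0 e0 (ltr0n R 2)).
have := h1 _ (leq_maxl N1 N2); have := h2 _ (leq_maxr N1 N2).
have := pdist_triangle (u (maxn N1 N2)) x y; rewrite (pdistC x (u _)).
by move=> *; lra.
Qed.

End Space.
End PNormedTheory.

Section CauchySequences.
Variables (R : realType) (p : exponent R) (V : pNormedType p).

(* The completion of V is the space of Cauchy sequences modulo the subspace of
   null sequences. *)
Definition cauchy_pred : {pred nat -> V} := fun u => `[< p_cauchy u >].

Lemma cauchy_pred_closed : submod_closed cauchy_pred.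
Proof.
split=> [|a u v /asboolP hu /asboolP hv]; apply/asboolP => e e0.
  by exists 0%N => m n _ _; rewrite /= pdistxx.
pose c := `|a| `^ p + 1.
have c0 : 0 < c by rewrite ltr_wpDl// powR_ge0.
have [N1 h1] := hu _ (divr_gt0 (divr_gt0 e0 (ltr0n R 2)) c0).
have [N2 h2] := hv _ (divr_gt0 e0 (ltr0n R 2)).
exists (maxn N1 N2) => m n; rewrite !geq_max => /andP[m1 m2] /andP[n1 n2].
rewrite (le_lt_trans (pdistD _ _ _ _))// pdistZ.
have := h2 _ _ m2 n2; have := h1 _ _ m1 n1; rewrite ltr_pdivlMr// /c mulrDr.
by rewrite mulr1 => h3; have := pdist_ge0 (u m) (u n) => *; lra.
Qed.

HB.instance Definition _ :=
  GRing.isSubmodClosed.Build R (nat -> V) cauchy_pred cauchy_pred_closed.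

Record cauchySeq :=
  CauchySeq { cseq :> nat -> V; cseqP : cseq \in cauchy_pred }.

HB.instance Definition _ := [isSub for cseq].
HB.instance Definition _ := [Choice of cauchySeq by <:].
HB.instance Definition _ := [SubChoice_isSubLmodule of cauchySeq by <:].

Definition null_pred : {pred cauchySeq} :=
  fun u => `[< p_converges u 0 >].

Lemma null_pred_closed : submod_closed null_pred.
Proof.
split=> [|a u v /asboolP hu /asboolP hv]; apply/asboolP => e e0.
  by exists 0%N => n _; rewrite /= pdistxx.
pose c := `|a| `^ p + 1.
have c0 : 0 < c by rewrite ltr_wpDl// powR_ge0.
have [N1 h1] := hu _ (divr_gt0 (divr_gt0 e0 (ltr0n R 2)) c0).
have [N2 h2] := hv _ (divr_gt0 e0 (ltr0n R 2)).
exists (maxn N1 N2) => n; rewrite !geq_max => /andP[n1 n2].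
rewrite -(addr0 0) -[X in pdist _ (X + _)](scaler0 _ a).
rewrite (le_lt_trans (pdistD _ _ _ _))// pdistZ.
have := h2 _ n2; have := h1 _ n1; rewrite ltr_pdivlMr// /c mulrDr.
by rewrite mulr1 => h3; have := pdist_ge0 (u n) 0 => *; lra.
Qed.

HB.instance Definition _ :=
  GRing.isSubmodClosed.Build R cauchySeq null_pred null_pred_closed.

Lemma cauchy_pnorm (u : cauchySeq) : cvgn (fun n => pnorm (u n) `^ p).
Proof.
apply/cauchy_cvgP/cauchy_exP => e e0.
have [N hN] := asboolW (cseqP u) _ e0.
exists (pnorm (u N) `^ p); exists N => // n /= Nn; rewrite /ball/=.
exact: le_lt_trans (ler_dist_pnorm _ _) (hN _ _ _ _).
Qed.

End CauchySequences.

Section Completion.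
Variables (R : realType) (p : exponent R) (V : pNormedType p).
Local Open Scope quotient_scope.

Definition completion := Quotient.quot (null_pred (V := V)).

HB.instance Definition _ := GRing.Zmodule.on completion.

Definition to_completion (u : cauchySeq V) : completion := \pi u.

Lemma to_completionP u v :
  to_completion u = to_completion v <-> p_converges (cseq (u - v)) 0.
Proof.
split=> [/eqP|]; first by rewrite -Quotient.idealrBE => /asboolP.
by move=> /asboolP h; apply/eqP; rewrite -Quotient.idealrBE.
Qed.

Lemma to_completionD : {morph to_completion : u v / u + v}.
Proof. by move=> u v; rewrite /to_completion !piE. Qed.

Lemma to_completionN : {morph to_completion : u / - u}.
Proof. by move=> u; rewrite /to_completion !piE. Qed.

Lemma to_completionB : {morph to_completion : u v / u - v}.
Proof. by move=> u v; rewrite to_completionD to_completionN. Qed.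

Lemma to_completion_repr x : to_completion (repr x) = x.
Proof. exact: reprK. Qed.

Lemma completion_surj x : exists u, x = to_completion u.
Proof. by exists (repr x); rewrite to_completion_repr. Qed.

Definition completion_scale (a : R) (x : completion) : completion :=
  to_completion (a *: repr x).

Lemma to_completion_scale a u :
  to_completion (a *: u) = completion_scale a (to_completion u).
Proof.
apply/to_completionP; rewrite -scalerBr.
suff /(rpredZ a) /asboolP : u - repr (to_completion u) \in null_pred (V := V).
  by [].
by apply/asboolP/to_completionP; rewrite to_completion_repr.
Qed.

Lemma completion_scaleA a b x :
  completion_scale a (completion_scale b x) = completion_scale (a * b) x.
Proof.
have [u ->] := completion_surj x.
by rewrite -!to_completion_scale scalerA.
Qed.

Lemma completion_scale1 : left_id 1 completion_scale.
Proof.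
move=> x; have [u ->] := completion_surj x.
by rewrite -!to_completion_scale scale1r.
Qed.

Lemma completion_scaleDr : right_distributive completion_scale +%R.
Proof.
move=> a x y; have [u ->] := completion_surj x; have [v ->] := completion_surj y.
by rewrite -to_completionD -!to_completion_scale scalerDr to_completionD.
Qed.

Lemma completion_scaleDl x :
  {morph completion_scale^~ x : a b / a + b}.
Proof.
move=> a b; have [u ->] := completion_surj x.
by rewrite -!to_completion_scale scalerDl to_completionD.
Qed.

HB.instance Definition _ := GRing.Zmodule_isLmodule.Build R completion
  completion_scaleA completion_scale1 completion_scaleDr completion_scaleDl.

Lemma to_completionZ a u : to_completion (a *: u) = a *: to_completion u.
Proof. exact: to_completion_scale. Qed.

End Completion.

(* ||x|| = (lim_n ||u_n|| ^ p) ^ (1/p) for a Cauchy sequence u representing x;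
   by completion_norm_powE the value does not depend on u. Locking prevents
   unification from unfolding the limit. *)
HB.lock Definition completion_norm (R : realType) (p : exponent R)
    (V : pNormedType p) (x : completion V) : R :=
  (limn (fun n => pnorm ((repr x : cauchySeq V) n) `^ p)) `^ (p : R)^-1.

Section CompletionNorm.
Variables (R : realType) (p : exponent R) (V : pNormedType p).
Implicit Types (u v : cauchySeq V) (x y : completion V).

Let lim_pow u : R := limn (fun n => pnorm (u n) `^ p).

Let lim_pow_ge0 u : 0 <= lim_pow u.
Proof.
apply: limr_ge; first exact: cauchy_pnorm.
by apply: nearW => n; exact: powR_ge0.
Qed.

Lemma completion_norm_powE u :
  completion_norm (to_completion u) `^ p = limn (fun n => pnorm (u n) `^ p).
Proof.
rewrite completion_norm.unlock.
set v : cauchySeq V := repr (to_completion u).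
have /to_completionP uv : to_completion v = to_completion u.
  exact: to_completion_repr.
rewrite (powR_expoVK p (lim_pow_ge0 v)); apply: cvg_lim => //.
rewrite -[limn _]add0r.
rewrite [X in X @ _ --> _](_ : _ = fun n =>
  (pnorm (v n) `^ p - pnorm (u n) `^ p) + pnorm (u n) `^ p); last first.
  by apply/funext => n; rewrite subrK.
apply: cvgD; last exact: cauchy_pnorm.
apply/cvgrPdist_lt => e e0; have [N hN] := uv _ e0.
exists N => // n /= Nn; rewrite sub0r normrN.
rewrite (le_lt_trans (ler_dist_pnorm _ _))//.
by have := hN _ Nn; rewrite /pdist subr0.
Qed.

Lemma completion_norm_ge0 x : 0 <= completion_norm x.
Proof. by rewrite completion_norm.unlock powR_ge0. Qed.

Lemma completion_norm_eq0 x : completion_norm x = 0 -> x = 0.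
Proof.
have [u ->] := completion_surj x => u0.
have := completion_norm_powE u; rewrite u0 powR0 ?expo_neq0// => /esym l0.
have : (fun n => pnorm (u n) `^ p) @ \oo --> (0 : R).
  by rewrite -l0; exact: cauchy_pnorm.
move=> /cvgrPdist_lt hu.
have -> : 0 = to_completion (0 : cauchySeq V).
  by rewrite -(subrr (to_completion 0)) -to_completionB subr0.
apply/to_completionP => e /hu [N _ hN]; exists N => n Nn.
have := hN n Nn; rewrite /= sub0r normrN ger0_norm ?powR_ge0//.
by rewrite /pdist !subr0.
Qed.

Lemma completion_normZ t x :
  completion_norm (t *: x) = `|t| * completion_norm x.
Proof.
have [u ->] := completion_surj x.
apply: (powR_injective (expo_gt0 p)); rewrite ?nnegrE.
- exact: completion_norm_ge0.
- exact: mulr_ge0 (normr_ge0 t) (completion_norm_ge0 _).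
rewrite (powRM _ (normr_ge0 t) (completion_norm_ge0 _)).
rewrite -to_completionZ !completion_norm_powE.
apply: cvg_lim => //; rewrite (_ : (fun n => _) =
    fun n => `|t| `^ p * pnorm (u n) `^ p); last first.
  by apply/funext => n; exact: pnorm_powZ.
by apply: cvgM; [exact: cvg_cst|exact: cauchy_pnorm].
Qed.

Lemma completion_norm_triangle x y :
  completion_norm (x + y) `^ p <=
  completion_norm x `^ p + completion_norm y `^ p.
Proof.
have [u ->] := completion_surj x; have [v ->] := completion_surj y.
rewrite -to_completionD !completion_norm_powE.
have cuv : (fun n => pnorm (u n) `^ p + pnorm (v n) `^ p) @ \oo -->
    limn (fun n => pnorm (u n) `^ p) + limn (fun n => pnorm (v n) `^ p).
  by apply: cvgD; exact: cauchy_pnorm.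
rewrite -(cvg_lim _ cuv)//; apply: ler_lim.
- exact: cauchy_pnorm.
- by apply/cvg_ex; eexists; exact: cuv.
- by apply: nearW => n; exact: pnorm_triangle.
Qed.

HB.instance Definition _ := Lmodule_isPNormed.Build R p (completion V)
  completion_norm_ge0 completion_norm_eq0 completion_normZ
  completion_norm_triangle.

Lemma const_cauchy (v : V) : (fun=> v) \in @cauchy_pred R p V.
Proof. by apply/asboolP => e e0; exists 0%N => m n _ _; rewrite pdistxx. Qed.

Definition completion_in (v : V) : completion V :=
  to_completion (CauchySeq (const_cauchy v)).

Lemma completion_in_linear : linear completion_in.
Proof.
move=> a u v; rewrite /completion_in -to_completionZ -to_completionD.
by congr to_completion; apply/val_inj.
Qed.

Lemma pnorm_completion_in (v : V) : pnorm (completion_in v) = pnorm v.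
Proof.
rewrite -[LHS](powR_expoK p (pnorm_ge0 _)) -[RHS](powR_expoK p (pnorm_ge0 _)).
congr (_ `^ _); rewrite [LHS]completion_norm_powE.
apply: cvg_lim => //=.
exact: (@cvg_cst R (pnorm v `^ p) nat \oo _).

Qed.

Lemma pdist_to_completion_le (u v : cauchySeq V) (e : R) N :
  (forall n, (N <= n)%N -> pdist (u n) (v n) <= e) ->
  pdist (to_completion u) (to_completion v) <= e.
Proof.
move=> uv; rewrite /pdist -to_completionB completion_norm_powE.
by apply: limr_le; [exact: cauchy_pnorm|exists N].
Qed.

Lemma completion_dense (x : completion V) (e : R) :
  0 < e -> exists v : V, pdist x (completion_in v) < e.
Proof.
move=> e0; have [u ->] := completion_surj x.
have [N hN] := asboolW (cseqP u) _ (divr_gt0 e0 (ltr0n R 2)).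
exists (u N); apply: (@le_lt_trans _ _ (e / 2)); last by lra.
by apply: (@pdist_to_completion_le _ _ _ N) => n Nn /=; exact/ltW/hN.
Qed.

Lemma pdist_completion_in (u v : V) :
  pdist (completion_in u) (completion_in v) = pdist u v.
Proof.
rewrite /pdist -pnorm_completion_in; congr (pnorm _ `^ _).
have := completion_in_linear (-1) v u.
by rewrite !scaleN1r addrC => <-; rewrite addrC.
Qed.

Lemma completion_complete (x : nat -> completion V) :
  p_cauchy x -> exists l, p_converges x l.
Proof.
move=> hx; have /choice[v hv] : forall k, exists v : V,
    pdist (x k) (completion_in v) < k.+1%:R^-1.
  by move=> k; apply: completion_dense; rewrite invr_gt0.
have small (e : R) : 0 < e -> exists N, forall k, (N <= k)%N ->
    pdist (x k) (completion_in (v k)) < e.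
  move=> e0; have [N _ hN] := near_infty_natSinv_lt (PosNum e0).
  by exists N => k Nk; exact: lt_trans (hv k) (hN k Nk).
have vc : v \in @cauchy_pred R p V.
  apply/asboolP => e e0.
  have [N1 h1] := small _ (divr_gt0 e0 (ltr0n R 3)).
  have [N2 h2] := hx _ (divr_gt0 e0 (ltr0n R 3)).
  exists (maxn N1 N2) => m n; rewrite !geq_max => /andP[m1 m2] /andP[n1 n2].
  have := pdist_triangle (x m) (completion_in (v m)) (completion_in (v n)).
  have := pdist_triangle (x n) (x m) (completion_in (v n)).
  have := h1 _ m1; have := h1 _ n1; have := h2 _ _ m2 n2.
  by rewrite pdist_completion_in (pdistC (completion_in _) (x m)) => *; lra.
exists (to_completion (CauchySeq vc)) => e e0.
have [N1 h1] := small _ (divr_gt0 e0 (ltr0n R 3)).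
have [N2 h2] := asboolW vc _ (divr_gt0 e0 (ltr0n R 3)).
exists (maxn N1 N2) => n; rewrite geq_max => /andP[n1 n2].
apply: le_lt_trans (pdist_triangle (completion_in (v n)) _ _) _.
have le3 : pdist (completion_in (v n)) (to_completion (CauchySeq vc)) <= e / 3.
  by apply: (@pdist_to_completion_le _ _ _ N2) => m Nm /=; exact/ltW/h2.
by have := h1 _ n1 => *; lra.
Qed.

HB.instance Definition _ :=
  PNormed_isComplete.Build R p (completion V) completion_complete.

End CompletionNorm.

Section ScalarPNorm.
Variables (R : realType) (p : exponent R).

Lemma regular_pnorm_triangle (x y : R^o) :
  `|x + y| `^ p <= `|x| `^ p + `|y| `^ p :> R.
Proof.
apply: le_trans (powR_subadd p (normr_ge0 _) (normr_ge0 _)).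
exact: ler_powR_expo (ler_normD _ _).
Qed.

HB.instance Definition _ := Lmodule_isPNormed.Build R p R^o
  (fun x => normr_ge0 (x : R)) (@normr0_eq0 R R) (@normrM R)
  regular_pnorm_triangle.

End ScalarPNorm.

Section FreeVectors.
Variables (R : realType) (M : metricType R) (x0 : M).

Definition lincomb (X : lmodType R) (f : M -> X) (s : seq (R * M)) : X :=
  \sum_(ax <- s) ax.1 *: f ax.2.

(* The space R_0^M; its elements are only used as arguments of functionals. *)
Definition based_fun := {f : M -> R | f x0 = 0}.

Definition eval_at (x : M) : based_fun -> R^o := fun f => sval f x.

(* The linear span of the evaluations in the space of all maps R_0^M -> R; all
   of its elements are linear functionals. *)
Definition free_span : {pred based_fun -> R^o} :=
  fun mu => `[< exists s, mu = lincomb eval_at s >].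

Lemma lincomb_cat (X : lmodType R) (f : M -> X) s t :
  lincomb f (s ++ t) = lincomb f s + lincomb f t.
Proof. exact: big_cat. Qed.

Lemma lincomb_scale (X : lmodType R) (f : M -> X) (a : R) s :
  lincomb f [seq (a * bx.1, bx.2) | bx <- s] = a *: lincomb f s.
Proof.
by rewrite /lincomb big_map scaler_sumr; apply: eq_bigr => b _; rewrite scalerA.
Qed.

Lemma free_span_closed : submod_closed free_span.
Proof.
split=> [|a u v /asboolP[s ->] /asboolP[t ->]]; apply/asboolP.
  by exists [::]; rewrite /lincomb big_nil.
exists ([seq (a * bx.1, bx.2) | bx <- s] ++ t).
by rewrite lincomb_cat lincomb_scale.
Qed.

HB.instance Definition _ :=
  GRing.isSubmodClosed.Build R (based_fun -> R^o) free_span free_span_closed.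

Record freeVec :=
  FreeVec { functional :> based_fun -> R^o; functionalP : functional \in free_span }.

HB.instance Definition _ := [isSub for functional].
HB.instance Definition _ := [Choice of freeVec by <:].
HB.instance Definition _ := [SubChoice_isSubLmodule of freeVec by <:].

Lemma eval_at_span x : eval_at x \in free_span.
Proof.
by apply/asboolP; exists [:: (1, x)]; rewrite /lincomb big_seq1 scale1r.
Qed.

Definition free_delta (x : M) : freeVec := FreeVec (eval_at_span x).

Lemma free_deltaP (mu : freeVec) : exists s, mu = lincomb free_delta s.
Proof.
have [s hs] := asboolW (functionalP mu); exists s; apply/val_inj; rewrite /= hs.
rewrite /lincomb; elim: s {hs} => [|a s IHs]; first by rewrite !big_nil.
by rewrite !big_cons IHs.
Qed.

Definition coef (s : seq (R * M)) (x : M) : R :=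
  \sum_(ax <- s) ax.1 * (ax.2 == x)%:R.

Lemma lincomb_coef (X : lmodType R) (f : M -> X) s (pts : seq M) :
  uniq pts -> {subset map snd s <= pts} ->
  lincomb f s = \sum_(x <- pts) coef s x *: f x.
Proof.
move=> upts spts; rewrite /coef.
under [RHS]eq_bigr do rewrite scaler_suml.
rewrite exchange_big/= /lincomb !big_seq; apply: eq_bigr => ax axs.
have axp : ax.2 \in pts by apply: spts; exact: map_f.
rewrite (bigD1_seq ax.2)//= eqxx mulr1 big1 ?addr0// => y yax.
by rewrite eq_sym (negPf yax) mulr0 scale0r.
Qed.

Lemma coef_eval_at s x (h : (fun y => (y == x)%:R) x0 = 0 :> R) :
  coef s x = lincomb eval_at s (exist _ (fun y => (y == x)%:R) h).
Proof.
rewrite /lincomb fct_sumE; apply: eq_bigr => a _.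
by [].
Qed.

Lemma eq_coef s t x : lincomb eval_at s = lincomb eval_at t -> x != x0 ->
  coef s x = coef t x.
Proof.
move=> st xx0; have h : (fun y => (y == x)%:R) x0 = 0 :> R.
  by rewrite eq_sym (negPf xx0).
by rewrite !(coef_eval_at _ h) st.
Qed.

Lemma eq_lincomb (X : lmodType R) (f : M -> X) s t : f x0 = 0 ->
  lincomb eval_at s = lincomb eval_at t -> lincomb f s = lincomb f t.
Proof.
move=> f0 st; pose pts := undup (map snd (s ++ t)).
have sub : {subset map snd s <= pts} /\ {subset map snd t <= pts}.
  by split=> x xs; rewrite mem_undup map_cat mem_cat xs ?orbT.
rewrite (@lincomb_coef _ f s pts) ?undup_uniq//; last by case: sub.
rewrite (@lincomb_coef _ f t pts) ?undup_uniq//; last by case: sub.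
apply: eq_bigr => x _; have [->|xx0] := eqVneq x x0; first by rewrite f0 !scaler0.
by rewrite (eq_coef st).
Qed.

Section FreeNorm.
Variable p : exponent R.

(* The functional mu may be written in several ways as a finite combination s
   of evaluations (x0 and repetitions are allowed in s); by eq_lincomb the vector
   lincomb f s does not depend on the choice of s since f x0 = 0. *)
Definition free_norm_set (mu : freeVec) : set R :=
  [set r | exists (X : pNormedType p) (f : M -> X) (s : seq (R * M)),
    [/\ f x0 = 0, forall x y, pnorm (f x - f y) <= mdist x y,
        functional mu = lincomb eval_at s & r = pnorm (lincomb f s)]].

Definition free_norm (mu : freeVec) : R := sup (free_norm_set mu).

Lemma pnorm_lincomb_le (X : pNormedType p) (f : M -> X) s :
  f x0 = 0 -> (forall x y, pnorm (f x - f y) <= mdist x y) ->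
  pnorm (lincomb f s) `^ p <= \sum_(ax <- s) (`|ax.1| * mdist ax.2 x0) `^ p.
Proof.
move=> f0 fL; elim: s => [|a s IHs].
  by rewrite /lincomb !big_nil pnorm0 powR0// expo_neq0.
rewrite /lincomb !big_cons; apply: le_trans (pnorm_triangle _ _) _.
rewrite lerD// pnormZ ler_powR_expo ?mulr_ge0 ?pnorm_ge0//.
by rewrite ler_wpM2l// -[f _]subr0 -f0 fL.
Qed.

Lemma free_norm_has_sup mu : has_sup (free_norm_set mu).
Proof.
have [s hs] := asboolW (functionalP mu); split.
  exists (@pnorm R p R^o (lincomb (fun=> 0 : R^o) s)), R^o, (fun=> 0), s.
  by split=> // x y; rewrite subrr pnorm0 mdist_ge0.
exists ((\sum_(ax <- s) (`|ax.1| * mdist ax.2 x0) `^ p) `^ (p : R)^-1).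
move=> _ [X [f [t [f0 fL ht ->]]]]; rewrite (@eq_lincomb _ f t s) -?ht//.
rewrite -[leLHS](powR_expoK p) ?pnorm_ge0//.
apply: ge0_ler_powR; rewrite ?invr_ge0 ?expo_ge0 ?nnegrE ?powR_ge0//.
  by apply: sumr_ge0 => *; exact: powR_ge0.
exact: pnorm_lincomb_le.
Qed.

Lemma free_norm_ub (X : pNormedType p) (f : M -> X) s (mu : freeVec) :
  f x0 = 0 -> (forall x y, pnorm (f x - f y) <= mdist x y) ->
  functional mu = lincomb eval_at s -> pnorm (lincomb f s) <= free_norm mu.
Proof.
move=> f0 fL hs; apply: ub_le_sup; first by case: (free_norm_has_sup mu).
by exists X, f, s.
Qed.

Lemma free_norm_le (mu : freeVec) (b : R) :
  (forall (X : pNormedType p) (f : M -> X) s, f x0 = 0 ->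
    (forall x y, pnorm (f x - f y) <= mdist x y) ->
    functional mu = lincomb eval_at s -> pnorm (lincomb f s) <= b) ->
  free_norm mu <= b.
Proof.
move=> h; apply: ge_sup; first by case: (free_norm_has_sup mu).
by move=> _ [X [f [s [f0 fL hs ->]]]]; exact: h.
Qed.

Lemma free_norm_ge0 mu : 0 <= free_norm mu.
Proof.
have [s hs] := asboolW (functionalP mu).
apply: le_trans (@free_norm_ub R^o (fun=> 0) s _ _ _ hs) => //.
  exact: pnorm_ge0.
by move=> x y; rewrite subrr pnorm0 mdist_ge0.
Qed.

Lemma free_norm_eq0 mu : free_norm mu = 0 -> mu = 0.
Proof.
have [s hs] := asboolW (functionalP mu) => mu0.
pose pts := undup (map snd s).
have upts : uniq pts by rewrite undup_uniq.
have spts : {subset map snd s <= pts} by move=> x; rewrite mem_undup.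
apply/val_inj; rewrite /= hs (@lincomb_coef _ eval_at s pts)//.
rewrite big1_seq// => x /= xpts.
have [->|xx0] := eqVneq x x0.
  by apply/funext => f; rewrite /= /eval_at fctE (svalP f) scaler0.
suff -> : coef s x = 0 by rewrite scale0r.
pose e : R := \big[Num.min/1]_(y <- x0 :: pts | y != x) mdist x y.
have e0 : 0 < e.
  by apply: lt_bigmin => // y yx; rewrite mdist_gt0 eq_sym.
have led y : y \in x0 :: pts -> y != x -> e <= mdist x y.
  by move=> yp yx; exact: ge_bigmin_seq.
pose f y : R^o := Num.max 0 (e - mdist x y).
have far y : y \in x0 :: pts -> y != x -> f y = 0.
  by move=> yp yx; apply/max_idPl; rewrite subr_le0 led.
have f0 : f x0 = 0 by rewrite far ?mem_head// eq_sym.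
have fL y z : @pnorm R p R^o (f y - f z) <= mdist y z.
  rewrite [leLHS]/(`|f y - f z|) /f.
  have h1 := metric_triangle x y z; have h2 := metric_triangle x z y.
  have h3 := mdist_ge0 y z.
  rewrite ler_norml; rewrite (metric_sym z y) in h2.
  by case: (leP 0 (e - mdist x y)) => ?; case: (leP 0 (e - mdist x z)) => ?;
    apply/andP; split; lra.
have := @free_norm_ub R^o f s mu f0 fL hs; rewrite mu0.
rewrite (@lincomb_coef _ f s pts)// (bigD1_seq x)//= big1_seq ?addr0; last first.
  by move=> y /andP[yx yp]; rewrite far ?scaler0// inE yp orbT.
have -> : f x = e by rewrite /f mdistxx subr0 max_r// ltW.
rewrite le_eqVlt ltNge pnorm_ge0 orbF => /eqP/pnorm_eq0/eqP.
by rewrite mulf_eq0 (gt_eqF e0) orbF => /eqP.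
Qed.

Lemma free_normZ t mu : free_norm (t *: mu) = `|t| * free_norm mu.
Proof.
have le a nu : free_norm (a *: nu) <= `|a| * free_norm nu.
  apply: free_norm_le => X f s f0 fL hs.
  have [r hr] := asboolW (functionalP nu).
  rewrite (@eq_lincomb _ f s [seq (a * bx.1, bx.2) | bx <- r])//; last first.
    by rewrite -hs lincomb_scale -hr.
  by rewrite lincomb_scale pnormZ ler_wpM2l// free_norm_ub.
apply/eqP; rewrite eq_le le/=; have [->|t0] := eqVneq t 0.
  by rewrite normr0 mul0r free_norm_ge0.
rewrite -ler_pdivlMl ?normr_gt0// -normfV.
by apply: le_trans (le t^-1 (t *: mu)); rewrite scalerA mulVf// scale1r.
Qed.

Lemma free_norm_triangle mu nu :
  free_norm (mu + nu) `^ p <= free_norm mu `^ p + free_norm nu `^ p.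
Proof.
set b := leRHS; have b0 : 0 <= b by rewrite addr_ge0// powR_ge0.
rewrite -(powR_expoVK p b0); apply: ler_powR_expo; first exact: free_norm_ge0.
apply: free_norm_le => X f s f0 fL hs.
have [r hr] := asboolW (functionalP mu); have [t ht] := asboolW (functionalP nu).
rewrite (@eq_lincomb _ f s (r ++ t))//; last by rewrite -hs lincomb_cat -hr -ht.
rewrite lincomb_cat -[leLHS](powR_expoK p) ?pnorm_ge0//.
apply: ge0_ler_powR; rewrite ?invr_ge0 ?expo_ge0 ?nnegrE ?powR_ge0//.
apply: le_trans (pnorm_triangle _ _) _.
by rewrite lerD// ler_powR_expo ?pnorm_ge0// free_norm_ub.
Qed.

End FreeNorm.
End FreeVectors.

(* A copy of freeVec x0 for each p, carrying the p-norm free_norm p. *)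
Definition free_pspace (R : realType) (M : metricType R) (x0 : M)
  (p : exponent R) : Type := freeVec x0.

Section FreePSpace.
Variables (R : realType) (M : metricType R) (x0 : M) (p : exponent R).

HB.instance Definition _ := GRing.Lmodule.on (free_pspace x0 p).
HB.instance Definition _ := Lmodule_isPNormed.Build R p (free_pspace x0 p)
  (@free_norm_ge0 R M x0 p) (@free_norm_eq0 R M x0 p)
  (@free_normZ R M x0 p) (@free_norm_triangle R M x0 p).

Definition lipschitz_free : pBanachType p := completion (free_pspace x0 p).

Definition lipschitz_free_delta (x : M) : lipschitz_free :=
  completion_in (free_delta x0 x : free_pspace x0 p).

End FreePSpace.

(* The envelope map is the bounded linear extension of the canonical embedding
   of M into the Lipschitz-free space with exponent 1. *)
Definition is_envelope_map (R : realType) (M : metricType R) (x0 : M)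
    (p : exponent R)
    (J : lipschitz_free x0 p -> lipschitz_free x0 (exponent1 R)) : Prop :=
  bounded_linear J /\
  forall x, J (lipschitz_free_delta x0 p x) =
            lipschitz_free_delta x0 (exponent1 R) x.

(* Main.v *)
Require Import Defs.
From HB Require Import structures.
From mathcomp Require Import all_boot all_order all_algebra.
From mathcomp Require Import all_classical all_reals all_analysis.
From mathcomp Require Import lra.
Import Order.TTheory GRing.Theory Num.Theory.
Local Open Scope ring_scope.

Set Implicit Arguments.
Unset Strict Implicit.
Unset Printing Implicit Defensive.

(* A Stechkin-type estimate. Let (u_n) be a p-Cauchy sequence of finitely
   supported elements tending to 0 for p = 1; fix u = u_n with N support points
   and w = u_m such that u - w is a combination of molecules whose coefficients
   satisfy sum |a_j|^p < e. With e = N t^p, at most N of the |a_j| exceed t, and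
   the others have sum at most e t^(1-p). Subtracting from u the molecules with
   large coefficients leaves an element with at most 3N support points and
   1-norm of order e t^(1-p), once m is large. By Caratheodory, that 1-norm is
   nearly attained by a combination of at most 3N molecules, so its p-th p-norm
   is of order 3N t^p + e. Hence the p-th p-norm of u is of order e. *)

(* Moving c along a linear relation between the rows of A, in a direction that
   does not increase the cost, until a coefficient vanishes. *)
Lemma conic_combination_drop (R : realFieldType) (V : lmodType R) (n d : nat)
    (A : 'M[R]_(n, d)) (b : 'I_d -> V) (w c : 'I_n -> R) :
  (d < n)%N -> (forall i, 0 <= w i) -> (forall i, 0 <= c i) ->
  exists (c' : 'I_n -> R) (j : 'I_n),
    [/\ forall i, 0 <= c' i, c' j = 0,
        \sum_i c' i *: (\sum_k A i k *: b k) =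
        \sum_i c i *: (\sum_k A i k *: b k)
      & \sum_i c' i * w i <= \sum_i c i * w i].
Proof.
move=> dn w0 c0.
have /rowV0Pn[t0 tA t0N0] : kermx A != 0.
  rewrite -mxrank_eq0 mxrank_ker subn_eq0 -ltnNge.
  exact: leq_ltn_trans (rank_leq_col A) dn.
have {tA} tA : t0 *m A = 0 by exact/sub_kermxP.
(* The sign of the relation is chosen so that the cost does not increase, and a negative entry is
   secured so that the motion must stop. *)
have [t [tA0 tw [j0 tj0]]] : exists t : 'rV[R]_n,
    [/\ t *m A = 0, \sum_i t 0 i * w i <= 0 & exists j, t 0 j < 0].
  have neg (s : 'rV[R]_n) : \sum_i (- s) 0 i * w i = - \sum_i s 0 i * w i.
    by rewrite -sumrN; apply: eq_bigr => i _; rewrite mxE mulNr.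
  have [s [sA sw sN0]] : exists s : 'rV[R]_n,
      [/\ s *m A = 0, \sum_i s 0 i * w i <= 0 & s != 0].
    have [tw|/ltW tw] := lerP (\sum_i t0 0 i * w i) 0; first by exists t0.
    by exists (- t0); rewrite neg mulNmx tA oppr0 oppr_le0 oppr_eq0.
  (* If [s] has no negative entry, it is nonnegative and so is its cost; then [- s] serves. *)
  have [/existsP[j sj]|/existsPn nn] := boolP [exists j, s 0 j < 0].
    by exists s; split=> //; exists j.
  have /rV0Pn[j sj] := sN0.
  exists (- s); rewrite neg mulNmx sA oppr0 oppr_le0; split=> //.
    by apply: sumr_ge0 => i _; rewrite mulr_ge0// leNgt nn.
  by exists j; rewrite mxE oppr_lt0 lt_neqAle eq_sym sj leNgt nn.
(* Ratio test: for a negative entry of [t], [r i] is the step at which coefficient i reaches 0. The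
   smallest such step keeps all coefficients nonnegative. *)
pose r i := c i / - t 0 i.
have [j tj jmin] := @arg_minP _ R _ j0 (fun i => t 0 i < 0) r tj0.
have rj0 : 0 <= r j by rewrite divr_ge0// oppr_ge0 ltW.
exists (fun i => c i + r j * t 0 i), j; split.
- move=> i; have [ti|ti] := lerP 0 (t 0 i);
    first exact: addr_ge0 (c0 i) (mulr_ge0 rj0 ti).
  have := jmin i ti; rewrite [leRHS]/r ler_pdivlMr ?oppr_gt0// mulrN.
  by rewrite -subr_ge0 opprK.
- by rewrite /r invrN mulrN mulNr -mulrA mulVf ?ltr0_neq0// mulr1 subrr.
- under eq_bigr do rewrite scalerDl.
  rewrite big_split/=; apply/eqP; rewrite addrC -subr_eq0 addrK; apply/eqP.
  under eq_bigr => i _ do rewrite -scalerA scaler_sumr.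
  rewrite -scaler_sumr exchange_big/= big1 ?scaler0// => k _.
  under eq_bigr do rewrite scalerA.
  rewrite -scaler_suml; have := congr1 (fun B : 'rV[R]_d => B 0 k) tA0.
  by rewrite !mxE => ->; rewrite scale0r.
- under eq_bigr do rewrite mulrDl -mulrA.
  by rewrite big_split/= -mulr_sumr gerDl mulr_ge0_le0.
Qed.

(** * Weighted edges representing elements of the span, and their costs *)

Section Flow.
Variables (R : realType) (M : metricType R) (x0 : M).
Implicit Types (s : seq (R * (M * M))) (pts : seq M) (mu : freeVec x0).
Local Notation delta := (free_delta x0).

(** An entry [(c, (x, y))] encodes the molecule of x and y with coefficient c d(x,y). Loops x = y
    are allowed: they contribute 0 and cost nothing for a positive exponent. *)
Definition flow s : freeVec x0 :=
  \sum_(e <- s) e.1 *: (delta e.2.1 - delta e.2.2).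

Definition flow_cost (q : R) s : R :=
  \sum_(e <- s) (`|e.1| * mdist e.2.1 e.2.2) `^ q.

Definition edges_in pts s : bool :=
  all (fun e => (e.2.1 \in pts) && (e.2.2 \in pts)) s.

Lemma flow_cat s t : flow (s ++ t) = flow s + flow t.
Proof. exact: big_cat. Qed.

Lemma flow_cost_cat q s t : flow_cost q (s ++ t) =
  flow_cost q s + flow_cost q t.
Proof. exact: big_cat. Qed.

Lemma edges_in_cat pts s t : edges_in pts (s ++ t) =
  edges_in pts s && edges_in pts t.
Proof. exact: all_cat. Qed.

Lemma flow_cost_ge0 q s : 0 <= flow_cost q s.
Proof. by apply: sumr_ge0 => e _; exact: powR_ge0. Qed.

Lemma flow_cost1 s : flow_cost 1 s = \sum_(e <- s) `|e.1| * mdist e.2.1 e.2.2.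
Proof. by apply: eq_bigr => e _; rewrite powRr1// mulr_ge0// mdist_ge0. Qed.

Lemma flow_scale a s : flow [seq (a * e.1, e.2) | e <- s] = a *: flow s.
Proof.
by rewrite /flow big_map scaler_sumr; apply: eq_bigr => e _; rewrite scalerA.
Qed.

Lemma flow_cost_scale (q : exponent R) a s :
  flow_cost q [seq (a * e.1, e.2) | e <- s] = `|a| `^ q * flow_cost q s.
Proof.
rewrite /flow_cost big_map mulr_sumr; apply: eq_bigr => e _.
by rewrite normrM -mulrA powRM// mulr_ge0// mdist_ge0.
Qed.

Lemma free_delta_base : delta x0 = 0.
Proof. by apply/val_inj/funext => h; exact: (svalP h). Qed.

Lemma flow_lincomb (r : seq (R * M)) :
  flow [seq (a.1, (a.2, x0)) | a <- r] = lincomb delta r.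
Proof.
by rewrite /flow big_map; apply: eq_bigr => a _; rewrite free_delta_base subr0.
Qed.

Lemma flow_surj mu : exists s, flow s = mu.
Proof.
by have [r ->] := free_deltaP mu; eexists; exact: flow_lincomb.
Qed.

Lemma functional_flow s h :
  functional (flow s) h = \sum_(e <- s) e.1 * (sval h e.2.1 - sval h e.2.2).
Proof.
rewrite /flow; elim: s => [|e s IHs]; first by rewrite !big_nil.
by rewrite !big_cons -IHs.
Qed.

Lemma functional_lincomb (r : seq (R * M)) h :
  functional (lincomb delta r) h = \sum_(a <- r) a.1 * sval h a.2.
Proof.
rewrite /lincomb; elim: r => [|e s IHs]; first by rewrite !big_nil.
by rewrite !big_cons -IHs.
Qed.

(** * The molecular formula for the norm *)

Section Norm.
Variable q : exponent R.

Lemma free_norm_delta_le x y : free_norm q (delta x - delta y) <= mdist x y.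
Proof.
apply: free_norm_le => X f s f0 fL hs.
rewrite (@eq_lincomb _ _ x0 _ f s [:: (1, x); (-1, y)])//; last first.
  rewrite -hs /lincomb !big_cons big_nil /= scale1r scaleN1r addr0//.
by rewrite /lincomb !big_cons big_nil /= scale1r scaleN1r addr0.
Qed.

Lemma free_norm_flow s : free_norm q (flow s) `^ q <= flow_cost q s.
Proof.
rewrite /flow /flow_cost; elim: s => [|e s IHs].
  rewrite !big_nil (_ : free_norm q 0 = 0) ?powR0 ?expo_neq0//.
  exact: (@pnorm0 R q (free_pspace x0 q)).
rewrite !big_cons; apply: le_trans (free_norm_triangle _ _ _) _.
rewrite lerD// ler_powR_expo ?free_norm_ge0// free_normZ ler_wpM2l//.
exact: free_norm_delta_le.
Qed.

Definition cost_set mu : set R :=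
  [set c | exists2 s, flow s = mu & flow_cost q s = c].

(** The q-th power of the infimum in the molecular formula. In this form, subadditivity is just
    concatenation of representations. *)
Definition min_cost mu : R := inf (cost_set mu).

Lemma min_cost_le s : min_cost (flow s) <= flow_cost q s.
Proof.
apply: ge_inf; last by exists s.
by exists 0 => _ [t _ <-]; exact: flow_cost_ge0.
Qed.

Lemma min_cost_lt mu e : min_cost mu < e ->
  exists2 s, flow s = mu & flow_cost q s < e.
Proof.
rewrite -subr_gt0 => e0; have [|_ [s sm <-]] := inf_adherent e0 (E :=
  cost_set mu).
  split; first by have [s sm] := flow_surj mu; exists (flow_cost q s), s.
  by exists 0 => _ [t _ <-]; exact: flow_cost_ge0.
by rewrite addrC subrK; exists s.
Qed.

Lemma min_cost_ge mu c : (forall s, flow s = mu -> c <= flow_cost q s) ->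
  c <= min_cost mu.
Proof.
move=> h; rewrite leNgt; apply/negP => /min_cost_lt[s /h].
by rewrite leNgt => /negP.
Qed.

Lemma min_cost_ge0 mu : 0 <= min_cost mu.
Proof. by apply: min_cost_ge => s _; exact: flow_cost_ge0. Qed.

Lemma min_costD mu nu : min_cost (mu + nu) <= min_cost mu + min_cost nu.
Proof.
apply/ler_addgt0Pr => e e0; have e2 : 0 < e / 2 by rewrite divr_gt0.
have [|s <- hs] := @min_cost_lt mu (min_cost mu + e / 2);
  first by rewrite ltrDl.
have [|t <- ht] := @min_cost_lt nu (min_cost nu + e / 2);
  first by rewrite ltrDl.
rewrite -flow_cat; apply: le_trans (min_cost_le _) _; rewrite flow_cost_cat;
  lra.
Qed.

Lemma min_costZ a mu : min_cost (a *: mu) = `|a| `^ q * min_cost mu.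
Proof.
have le b nu : min_cost (b *: nu) <= `|b| `^ q * min_cost nu.
  have [->|b0] := eqVneq b 0.
    rewrite normr0 powR0 ?expo_neq0// mul0r scale0r.
    by have := min_cost_le [::]; rewrite /flow /flow_cost !big_nil.
  have b1 : 0 < `|b| `^ q by rewrite powR_gt0 ?normr_gt0.
  rewrite -ler_pdivrMl//; apply: min_cost_ge => s <-.
  by rewrite ler_pdivrMl// -flow_cost_scale -flow_scale min_cost_le.
apply/eqP; rewrite eq_le le/=; have [->|a0] := eqVneq a 0.
  by rewrite normr0 powR0 ?expo_neq0// mul0r min_cost_ge0.
have a1 : 0 < `|a| `^ q by rewrite powR_gt0 ?normr_gt0.
(* The converse inequality is [le] for the scalar a^-1 and the vector a mu. *)
rewrite -ler_pdivlMl//; apply: le_trans (_ : _ <=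
  min_cost (a^-1 *: (a *: mu))) _.
  by rewrite scalerA mulVf// scale1r.
by apply: le_trans (le _ _) _;
  rewrite normfV -powR_inv1 // -powRAC powR_inv1 ?powR_ge0.
Qed.

Lemma free_norm_le_min_cost mu : free_norm q mu `^ q <= min_cost mu.
Proof. by apply: min_cost_ge => s <-; exact: free_norm_flow. Qed.

End Norm.

End Flow.

(** A separate copy of [freeVec], indexed by [q], that can carry a p-norm other than the one on
    [free_pspace]. *)
Definition molecular_space (R : realType) (M : metricType R) (x0 : M)
  (q : exponent R) : Type := freeVec x0.

Section MolecularNorm.
Variables (R : realType) (M : metricType R) (x0 : M) (q : exponent R).
Local Notation V := (molecular_space x0 q).

HB.instance Definition _ := GRing.Lmodule.on V.

Definition molecular_norm (mu : V) : R :=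
  min_cost q (mu : freeVec x0) `^ (q : R)^-1.

Lemma molecular_norm_powE mu : molecular_norm mu `^ q =
  min_cost q (mu : freeVec x0).
Proof. by rewrite powR_expoVK// min_cost_ge0. Qed.

Lemma molecular_norm_ge0 mu : 0 <= molecular_norm mu.
Proof. exact: powR_ge0. Qed.

(** Definiteness is inherited from [free_norm], whose q-th power is dominated by [min_cost]. *)
Lemma molecular_norm_eq0 mu : molecular_norm mu = 0 -> mu = 0.
Proof.
move=> mu0; have := molecular_norm_powE mu.
rewrite mu0 powR0 ?expo_neq0// => c0.
have := free_norm_le_min_cost q (mu : freeVec x0); rewrite -c0 => le0.
apply: (@free_norm_eq0 R M x0 q); apply: (@powR_eq0_eq0 _ _ q).
by apply/eqP; rewrite eq_le le0 powR_ge0.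
Qed.

Lemma molecular_normZ a mu : molecular_norm (a *: mu) =
  `|a| * molecular_norm mu.
Proof.
by rewrite /molecular_norm min_costZ powRM ?powR_ge0 ?min_cost_ge0// powR_expoK.
Qed.

Lemma molecular_norm_triangle mu nu :
  molecular_norm (mu + nu) `^ q <=
    molecular_norm mu `^ q + molecular_norm nu `^ q.
Proof. by rewrite !molecular_norm_powE min_costD. Qed.

HB.instance Definition _ := Lmodule_isPNormed.Build R q V
  molecular_norm_ge0 molecular_norm_eq0 molecular_normZ molecular_norm_triangle.

(* The map delta into molecular_space is 1-Lipschitz, hence competes in the
   supremum defining free_norm. *)
Lemma min_cost_le_free_norm (mu : freeVec x0) :
  min_cost q mu <= free_norm q mu `^ q.
Proof.
have [r hr] := free_deltaP mu.
rewrite -(molecular_norm_powE mu) ler_powR_expo ?molecular_norm_ge0//.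
rewrite {1}hr; apply: (@free_norm_ub R M x0 q V (free_delta x0)).
- exact: free_delta_base.
- move=> x y; rewrite -[leRHS](powR_expoK q (mdist_ge0 _ _)) /pnorm/=.
  rewrite /molecular_norm ge0_ler_powR ?nnegrE ?invr_ge0 ?expo_ge0
    ?min_cost_ge0//.
    exact: powR_ge0.
  have := min_cost_le x0 q [:: (1, (x, y))].
  by rewrite /flow /flow_cost !big_seq1 /= scale1r normr1 mul1r.
- by rewrite hr /lincomb; elim: r {hr} => [|a r IH];
    rewrite ?big_nil// !big_cons -IH.
Qed.

(** The form in which the molecular formula is used later: a norm defined as a supremum yields
    near-optimal representations. *)
Lemma free_norm_flow_exists (mu : freeVec x0) (e : R) : free_norm q mu `^ q < e
  ->
  exists2 s, flow x0 s = mu & flow_cost q s < e.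
Proof. by move=> mue; apply: min_cost_lt; apply: le_lt_trans mue;
  exact: min_cost_le_free_norm. Qed.

End MolecularNorm.

Lemma sum_product_weights (R : fieldType) (V : lmodType R) (T : Type)
    (l : seq T) (a b : T -> R) (F G : T -> V) (S : R) :
  S != 0 -> \sum_(i <- l) a i = S -> \sum_(i <- l) b i = S ->
  \sum_(i <- l) \sum_(j <- l) (a i * b j / S) *: (F i + G j) =
  \sum_(i <- l) a i *: F i + \sum_(i <- l) b i *: G i.
Proof.
move=> S0 sa sb.
(* The weights a_i b_j / S form a coupling with marginals a and b, so each summand only sees its own
   marginal. *)
under eq_bigr => i _ do under eq_bigr => j _ do rewrite scalerDr.
under eq_bigr do rewrite big_split/=.
rewrite big_split/=; congr (_ + _).
  apply: eq_bigr => i _; rewrite -scaler_suml -mulr_suml -mulr_sumr sb.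
  by rewrite mulfK.
rewrite exchange_big/=; apply: eq_bigr => j _; rewrite -scaler_suml -mulr_suml.
by rewrite -mulr_suml sa mulrAC divff// mul1r.
Qed.

Section Reduction.
Variables (R : realType) (M : metricType R) (x0 : M).
Implicit Types (s : seq (R * (M * M))) (pts : seq M).
Local Notation delta := (free_delta x0).

(* The mass that the star routes through v is sent directly between its
   leaves, in proportion to the positive and negative parts of the
   coefficients; by the triangle inequality the cost does not increase. *)
Lemma balanced_star_flow v pts (l : seq (R * M)) :
  all (fun a => a.2 \in pts) l -> \sum_(a <- l) a.1 = 0 ->
  exists s, [/\ edges_in pts s,
    flow x0 s = \sum_(a <- l) a.1 *: (delta a.2 - delta v)
    & flow_cost 1 s <= \sum_(a <- l) `|a.1| * mdist a.2 v].
Proof.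
(* Since the coefficients sum to 0, S is the common total of their positive and of their negative
   parts. *)
move=> lpts l0; pose S : R := (\sum_(a <- l) `|a.1|) / 2.
have [S0|S0] := eqVneq S 0.
  exists [::]; split=> //; last first.
    rewrite /flow_cost big_nil; apply: sumr_ge0 => a _.
    by rewrite mulr_ge0// mdist_ge0.
  have : \sum_(a <- l) `|a.1| == 0 by move: S0 => /eqP;
    rewrite mulf_eq0 invr_eq0 pnatr_eq0 orbF.
  rewrite psumr_eq0// => /allP h; rewrite /flow big_nil big1_seq// => a /= al.
  by have /= := h a al; rewrite normr_eq0 => /eqP ->; rewrite scale0r.
pose pos (a : R * M) := (`|a.1| + a.1) / 2;
  pose neg (a : R * M) := (`|a.1| - a.1) / 2.
have pos0 a : 0 <= pos a.
  by rewrite divr_ge0// -lerBlDr sub0r -normrN ler_norm.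
have neg0 a : 0 <= neg a by rewrite divr_ge0// subr_ge0 ler_norm.
have posS : \sum_(a <- l) pos a = S by rewrite -mulr_suml big_split/= l0 addr0.
have negS : \sum_(a <- l) neg a = S by rewrite -mulr_suml sumrB l0 subr0.
have S_ge0 : 0 <= S by rewrite divr_ge0// sumr_ge0.
exists [seq (pos a * neg b / S, (a.2, b.2)) | a <- l, b <- l]; split.
- apply/allP => e /allpairsP[[a b] /= [al bl ->]] /=.
  by rewrite !(allP lpts).
- rewrite /flow big_allpairs_dep /=.
  (* Inserting v writes each leaf-to-leaf edge as a difference of two rays, to which the marginals
     apply. *)
  under eq_bigr => a _ do under eq_bigr => b _ do
    rewrite -(subrKA (delta v)) -[delta v - _]opprB.
  rewrite (@sum_product_weights _ _ _ _ pos neg (fun a => delta a.2 - delta v)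
     (fun a => - (delta a.2 - delta v)) S)//.
  rewrite -big_split; apply: eq_bigr => a _ /=.
  by rewrite scalerN -scalerBl (_ : pos a - neg a = a.1)// /pos /neg; lra.
- rewrite flow_cost1 big_allpairs_dep /=.
  apply: le_trans (_ : \sum_(a <- l) \sum_(b <- l)
    (pos a * neg b / S) * (mdist a.2 v + mdist b.2 v) <= _).
    apply: ler_sum => a _; apply: ler_sum => b _.
    have w0 : 0 <= pos a * neg b / S by rewrite divr_ge0// mulr_ge0.
    by rewrite ger0_norm// ler_wpM2l// [mdist b.2 v]metric_sym metric_triangle.
  rewrite (@sum_product_weights R R^o _ _ pos neg (fun a => mdist a.2 v)
     (fun a => mdist a.2 v) S)// -big_split/=.
  rewrite le_eqVlt; apply/orP; left; apply/eqP; apply: eq_bigr => a _.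
  by rewrite -scalerDl (_ : pos a + neg a = `|a.1|)// /pos /neg; lra.
Qed.

(** Edges meeting v are oriented towards v and collected in the star [l]; loops at v are dropped,
    and the remaining edges form [k]. *)
Lemma split_star v pts s : edges_in (v :: pts) s ->
  exists k (l : seq (R * M)),
    [/\ edges_in pts k, all (fun a => a.2 \in pts) l,
     flow x0 s = flow x0 k + \sum_(a <- l) a.1 *: (delta a.2 - delta v)
     & flow_cost 1 s = flow_cost 1 k + \sum_(a <- l) `|a.1| * mdist a.2 v].
Proof.
rewrite !flow_cost1; elim: s => [_|[c [x y]] s IHs] /=.
  by exists [::], [::]; rewrite /flow !flow_cost1 !big_nil !addr0.
move=> /andP[/andP[]]; rewrite !inE => xp yp /IHs[k [l [kp lp fE cE]]].
rewrite !flow_cost1 in cE *;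
  rewrite {1}/flow !big_cons/= -/(flow _ s) fE cE {IHs fE cE}.
have [xv|xv] := eqVneq x v.
  have [yv|yv] := eqVneq y v.
    by exists k, l; rewrite flow_cost1 xv yv subrr scaler0 mdistxx mulr0 !add0r.
  rewrite (negPf yv) /= in yp.
  exists k, ((- c, y) :: l); rewrite flow_cost1 /= yp !big_cons/=; split=> //.
    by rewrite xv addrCA scaleNr -scalerN opprB.
  by rewrite xv normrN (metric_sym v) addrCA.
rewrite (negPf xv)/= in xp.
have [yv|yv] := eqVneq y v.
  exists k, ((c, x) :: l); rewrite flow_cost1 /= xp !big_cons/=; split=> //.
    by rewrite yv addrCA.
  by rewrite yv addrCA.
rewrite (negPf yv)/= in yp.
by exists ((c, (x, y)) :: k), l;
  rewrite flow_cost1 /flow /= !big_cons xp yp /= !addrA.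
Qed.

(** This says by duality that mu is supported in [pts], without choosing a representation of mu. *)
Definition vanishes_off pts (mu : freeVec x0) : Prop :=
  forall h, (forall x, x \in pts -> sval h x = 0) -> functional mu h = 0.

(** The indicator of v is based because x0 lies in [pts], and it vanishes on [pts]. Evaluated on the
    flow it gives the sum of the coefficients of the star at v. That sum is thus 0, and
    [balanced_star_flow] replaces the star. *)
Lemma bypass_vertex v pts s : x0 \in pts -> v \notin pts ->
  vanishes_off pts (flow x0 s) -> edges_in (v :: pts) s ->
  exists s', [/\ edges_in pts s', flow x0 s' = flow x0 s
    & flow_cost 1 s' <= flow_cost 1 s].
Proof.
move=> x0p vp s0 /split_star[k [l [kp lp fE cE]]].
have h0 : (fun y => (y == v)%:R) x0 = 0 :> R.
  by case: eqP => // x0v; rewrite -x0v x0p in vp.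
pose h : based_fun x0 := exist _ (fun y => (y == v)%:R) h0.
have hp x : x \in pts -> (x == v) = false.
  by move=> xp; case: eqP => // xv; rewrite -xv xp in vp.
have l0 : \sum_(a <- l) a.1 = 0.
  have := s0 h (fun x xp => congr1 (fun b : bool => b%:R) (hp x xp));
    rewrite fE.
  have -> : functional (flow x0 k + \sum_(a <- l) a.1 *: (delta a.2 - delta v))
    h =
     functional (flow x0 (k ++ [seq (a.1, (a.2, v)) | a <- l])) h.
    by rewrite flow_cat /flow big_map.
  rewrite functional_flow big_cat big_map /= big1_seq ?add0r; last first.
    by move=> e /= /(allP kp)/andP[e1 e2];
      rewrite (hp _ e1) (hp _ e2) subrr mulr0.
  rewrite big_seq eqxx.
  under eq_bigr => a al do rewrite (hp _ (allP lp _ al)) sub0r mulrN1.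
  by rewrite -big_seq sumrN => /eqP; rewrite oppr_eq0 => /eqP.
have [t [tp tE tc]] := balanced_star_flow v lp l0.
exists (k ++ t); rewrite edges_in_cat kp tp flow_cat flow_cost_cat; split=> //.
  by rewrite fE tE.
by rewrite cE lerD2l.
Qed.

Lemma edges_in_sub pts pts' s : {subset pts <= pts'} -> edges_in pts s ->
  edges_in pts' s.
Proof. by move=> sub; apply: sub_all => e /andP[/sub-> /sub->]. Qed.

(** All endpoints of [s] are listed as extra vertices [W] and bypassed one at a time. *)
Lemma bypass_vertices pts s : x0 \in pts -> vanishes_off pts (flow x0 s) ->
  exists s', [/\ edges_in pts s', flow x0 s' = flow x0 s
    & flow_cost 1 s' <= flow_cost 1 s].
Proof.
move=> x0p s0.
have [W sW] : exists W, edges_in (W ++ pts) s.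
  exists (map (fun e => e.2.1) s ++ map (fun e => e.2.2) s).
  apply/allP => e es; rewrite !mem_cat.
  by rewrite (map_f (fun e : R * (M * M) => e.2.1) es)
    (map_f (fun e : R * (M * M) => e.2.2) es) !orbT.
elim: W s s0 sW => [|v W IHW] s s0 sW; first by exists s.
(* A vertex that is repeated or already in [pts] is simply dropped from the list. *)
have [vW|vW] := boolP (v \in W ++ pts).
  apply: IHW => //; apply: edges_in_sub sW => x.
  by rewrite /= inE => /orP[/eqP->|].
have [||s1 [s1p s1E s1c]] := bypass_vertex _ vW _ sW.
- by rewrite mem_cat x0p orbT.
- by move=> h hp; apply: s0 => x xp; apply: hp; rewrite mem_cat xp orbT.
have [|s2 [s2p s2E s2c]] := IHW s1 _ s1p; first by rewrite s1E.
by exists s2; rewrite s2E s1E; split=> //; exact: le_trans s2c s1c.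
Qed.

(** Reversing an edge changes the sign of its coefficient. This provides the nonnegative
    coefficients that [conic_combination_drop] asks for. *)
Lemma nonneg_flow pts s : edges_in pts s -> exists s',
  [/\ edges_in pts s', all (fun e => 0 <= e.1) s', flow x0 s' = flow x0 s,
      flow_cost 1 s' = flow_cost 1 s & size s' = size s].
Proof.
rewrite !flow_cost1; elim: s => [|[c [x y]] s IHs] /=.
  by exists [::]; rewrite flow_cost1.
move=> /andP[/andP[xp yp] /IHs[t [tp t0 tE tc tz]]].
rewrite flow_cost1 in tc; have [c0|c0] := lerP 0 c.
  exists ((c, (x, y)) :: t); rewrite flow_cost1 /= xp yp /= c0 tz.
  by split=> //; rewrite ?/flow !big_cons/= ?tc// -!/(flow _ _) tE.
exists ((- c, (y, x)) :: t); rewrite flow_cost1 /= xp yp /= tz oppr_ge0 ltW//.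
split=> //; rewrite ?/flow !big_cons/= ?tc//.
  by rewrite -!/(flow _ _) tE scaleNr -scalerN opprB.
by rewrite normrN metric_sym.
Qed.

(** Caratheodory: as long as there are more edges than points, a linear relation between the edges
    allows one of them to be dropped at no extra cost. *)
Lemma sparse_flow pts s : edges_in pts s -> exists s',
  [/\ flow x0 s' = flow x0 s, flow_cost 1 s' <= flow_cost 1 s
    & (size s' <= size pts)%N].
Proof.
(* With distinct points, the expansion [deltaE] has exactly one nonzero coefficient. *)
wlog ptsU : pts / uniq pts => [wl|] sp.
  have [|s' [h1 h2 h3]] := wl (undup pts) (undup_uniq _).
    by apply: edges_in_sub sp => x; rewrite mem_undup.
  by exists s'; split=> //; apply: leq_trans h3 (size_undup _).
have [n] := ubnP (size s); elim: n s sp => // n IHn s sp sn.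
have [sd|ds] := leqP (size s) (size pts); first by exists s.
have [s1 [s1p s10 <- <- s1z]] := nonneg_flow sp; rewrite -s1z in ds sn.
move: {s sp s1z} s1 s1p s10 ds sn => s sp s0 ds sn.
pose e0 := (0 : R, (x0, x0)); pose e i := nth e0 s i.
have es (i : 'I_(size s)) : e i \in s by exact: mem_nth.
(* The incidence matrix: row i expresses edge i through the evaluations at [pts]. *)
pose A : 'M[R]_(size s, size pts) :=
  \matrix_(i, k) (((e i).2.1 == nth x0 pts k)%:R -
    ((e i).2.2 == nth x0 pts k)%:R).
have deltaE x : x \in pts ->
  delta x = \sum_(k < size pts) (x == nth x0 pts k)%:R *: delta (nth x0 pts k).
  move=> xp; rewrite -(big_mkord xpredT (fun k => (x == nth x0 pts k)%:R *:
    delta (nth x0 pts k))).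
  rewrite -(big_nth x0 xpredT (fun y => (x == y)%:R *: delta y)).
  rewrite (bigD1_seq x)//= eqxx scale1r big1 ?addr0// => y yx.
  by rewrite eq_sym (negPf yx) scale0r.
have eE (i : 'I_(size s)) : delta (e i).2.1 - delta (e i).2.2 =
    \sum_k A i k *: delta (nth x0 pts k).
  have /andP[p1 p2] := allP sp _ (es i).
  rewrite (deltaE _ p1) (deltaE _ p2) -sumrB; apply: eq_bigr => k _.
  by rewrite mxE scalerBl.
have [|i|c [j [c0 cj cE cw]]] := @conic_combination_drop R _ _ _ A
    (fun k => delta (nth x0 pts k)) (fun i => mdist (e i).2.1 (e i).2.2)
    (fun i => (e i).1) ds.
- by move=> i; exact: mdist_ge0.
- exact: (allP s0).
pose s' := [seq (c i, (e i).2) | i <- enum (predC1 j)].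
have s'z : (size s' < size s)%N.
  rewrite size_map -cardE cardC1 card_ord prednK//; exact: leq_ltn_trans ds.
have s'p : edges_in pts s'.
  by apply/allP => _ /mapP[i _ ->] /=; exact: (allP sp).
have [|s2 [s2E s2c s2z]] := IHn s' s'p; first exact: leq_trans s'z _.
exists s2; split=> //.
- rewrite s2E /flow big_map big_enum/= [RHS](big_nth e0) big_mkord.
  rewrite [RHS](eq_bigr (fun i : 'I_(size s) => (e i).1 *: \sum_k A i k *:
    delta (nth x0 pts k))); last first.
    by move=> i _; rewrite -eE.
  rewrite -cE [RHS](bigD1 j)//= cj scale0r add0r; apply: eq_bigr => i _.
  by rewrite eE.
- apply: le_trans s2c _; rewrite !flow_cost1 big_map big_enum/=
    [leRHS](big_nth e0) big_mkord.
  have -> : \sum_(i < size s)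
      `|(nth e0 s i).1| * mdist (nth e0 s i).2.1 (nth e0 s i).2.2 =
    \sum_(i < size s) (e i).1 * mdist (e i).2.1 (e i).2.2.
    by apply: eq_bigr => i _; rewrite ger0_norm//; exact: (allP s0).
  apply: le_trans cw; rewrite [leRHS](bigD1 j)//= cj mul0r add0r.
  by apply: ler_sum => i _; rewrite ger0_norm.
Qed.

End Reduction.

(** * Threshold inequalities for powers and the sparse estimate *)

Section PowerThreshold.
Variables (R : realType) (p : exponent R) (a t : R).
Hypotheses (a_ge0 : 0 <= a) (t_gt0 : 0 < t).

(** As p - 1 <= 0, the power with exponent p - 1 decreases. Both bounds below write a^p as a a^(p-1)
    and compare it with a t^(p-1). *)
Let powR_sub1_anti (x y : R) : 0 < x -> x <= y ->
  y `^ ((p : R) - 1) <= x `^ ((p : R) - 1).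
Proof.
move=> x0 xy; have y0 := lt_le_trans x0 xy; rewrite -opprB !powRN.
rewrite lef_pV2 ?posrE ?powR_gt0// ge0_ler_powR ?nnegrE ?(ltW x0) ?(ltW y0)//.
by rewrite subr_ge0 expo_le1.
Qed.

Lemma mul_powR_sub1_le : a <= t -> a * t `^ ((p : R) - 1) <= a `^ p.
Proof.
move=> at_; have [->|aN0] := eqVneq a 0; first by rewrite mul0r powR_ge0.
have a0 : 0 < a by rewrite lt_neqAle eq_sym aN0.
by rewrite -(mulr_powRB1 a_ge0 (expo_gt0 p)) ler_wpM2l// powR_sub1_anti.
Qed.

Lemma powR_le_threshold : a `^ p <= t `^ p + a * t `^ ((p : R) - 1).
Proof.
have [at_|ta] := lerP a t.
  by rewrite ler_wpDr ?mulr_ge0 ?powR_ge0// ler_powR_expo.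
rewrite ler_wpDl ?powR_ge0// -(mulr_powRB1 a_ge0 (expo_gt0 p)) ler_wpM2l//.
exact/powR_sub1_anti/ltW.
Qed.

End PowerThreshold.

Section SparseEstimate.
Variables (R : realType) (M : metricType R) (x0 : M) (p : exponent R).
Implicit Types (s : seq (R * (M * M))) (pts : seq M) (mu nu : freeVec x0).

(** Few edges and a small 1-cost together force a small p-cost, by [powR_le_threshold] on each
    edge. *)
Lemma flow_cost_le_size s t : 0 < t ->
  flow_cost p s <= (size s)%:R * t `^ p + flow_cost 1 s * t `^ ((p : R) - 1).
Proof.
move=> t0; rewrite !flow_cost1 /flow_cost; elim: s => [|e s IHs].
  by rewrite !big_nil !mul0r addr0.
rewrite !big_cons /= -nat1r !mulrDl mul1r addrACA lerD//.
by rewrite powR_le_threshold// mulr_ge0// mdist_ge0.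
Qed.

Let small t s := [seq e <- s | `|e.1| * mdist e.2.1 e.2.2 <= t].
Let large t s := [seq e <- s | t < `|e.1| * mdist e.2.1 e.2.2].

Let flow_split t s : flow x0 s = flow x0 (large t s) + flow x0 (small t s).
Proof.
rewrite /flow !big_filter [LHS](bigID
  (fun e => t < `|e.1| * mdist e.2.1 e.2.2))/=.
by congr (_ + _); apply: eq_bigl => e; rewrite -leNgt.
Qed.

Let flow_cost_split q t s : flow_cost q s =
  flow_cost q (large t s) + flow_cost q (small t s).
Proof.
rewrite /flow_cost !big_filter [LHS](bigID
  (fun e => t < `|e.1| * mdist e.2.1 e.2.2))/=.
by congr (_ + _); apply: eq_bigl => e; rewrite -leNgt.
Qed.

(** Chebyshev's inequality: each large edge costs at least t^p. *)
Let size_large_le t s : 0 < t ->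
  (size (large t s))%:R * t `^ p <= flow_cost p (large t s).
Proof.
move=> t0; have := filter_all (fun e => t < `|e.1| * mdist e.2.1 e.2.2) s.
rewrite -/(large t s) /flow_cost; elim: (large t s) => [|e r IHr] /=.
  by rewrite big_nil mul0r.
move=> /andP[te /IHr h]; rewrite big_cons -nat1r mulrDl mul1r lerD//.
by rewrite ler_powR_expo// ltW.
Qed.

Let cost1_small_le t s : 0 < t ->
  flow_cost 1 (small t s) * t `^ ((p : R) - 1) <= flow_cost p (small t s).
Proof.
move=> t0; rewrite flow_cost1 mulr_suml /flow_cost /small !big_filter;
  apply: ler_sum => e et.
by rewrite mul_powR_sub1_le// mulr_ge0// mdist_ge0.
Qed.

Lemma free_norm1_triangle mu nu : free_norm (exponent1 R) (mu + nu) <=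
  free_norm (exponent1 R) mu + free_norm (exponent1 R) nu.
Proof.
by have := free_norm_triangle (exponent1 R) mu nu;
  rewrite /= !powRr1 ?free_norm_ge0.
Qed.

Lemma free_norm1_flow s : free_norm (exponent1 R) (flow x0 s) <= flow_cost 1 s.
Proof.
by have := free_norm_flow x0 (exponent1 R) s; rewrite /= powRr1 ?free_norm_ge0.
Qed.

(** In the application mu is a fixed term of the Cauchy sequence and nu a later one, so nu can be
    made small in the 1-norm after t has been fixed by the support of mu. *)
Lemma free_norm_le_sparse pts mu nu (e t : R) :
  x0 \in pts -> vanishes_off pts mu -> 0 < t -> (size pts)%:R * t `^ p <= e ->
  free_norm p (mu - nu) `^ p < e ->
  free_norm (exponent1 R) nu * t `^ ((p : R) - 1) < e ->
  free_norm p mu `^ p <= 6 * e.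
Proof.
move=> x0p mu0 t0 Ne /free_norm_flow_exists[s sE se] nue.
set k := t `^ _ in nue; have k0 : 0 < k by rewrite powR_gt0.
pose B := large t s; pose S := small t s.
have eE := flow_split t s; rewrite -/B -/S in eE.
have ce := flow_cost_split p t s; rewrite -/B -/S in ce.
have Bz : (size B)%:R * t `^ p <= flow_cost p B by exact: size_large_le.
have Sc : flow_cost 1 S * k <= flow_cost p S by exact: cost1_small_le.
have Bge0 : 0 <= flow_cost p B := flow_cost_ge0 _ _.
have Sge0 : 0 <= flow_cost p S := flow_cost_ge0 _ _.
(* Once the large edges are removed from mu, there remain nu and the small edges; each has 1-norm at
   most e / k. *)
have rhoE : mu - flow x0 B = nu + flow x0 S.
  by apply/eqP; rewrite subr_eq -addrA (addrC (flow x0 S)) -eE sE addrC subrK.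
have rho1 : free_norm (exponent1 R) (mu - flow x0 B) `^ exponent1 R < 2 * e / k.
  rewrite /= powRr1 ?free_norm_ge0// rhoE ltr_pdivlMr//.
  have := free_norm1_triangle nu (flow x0 S); have := free_norm1_flow S.
  move=> h1 h2; have : free_norm (exponent1 R) (nu + flow x0 S) * k <=
      free_norm (exponent1 R) nu * k + flow_cost 1 S * k.
    by rewrite -mulrDl ler_wpM2r ?(ltW k0)//; lra.
  lra.
have [s1 s1E s1c] := free_norm_flow_exists rho1.
(* These points carry the remainder. Each large edge adds two endpoints, and there are fewer than e
   / t^p large edges. *)
pose pts' := pts ++ (map (fun e => e.2.1) B ++ map (fun e => e.2.2) B).
have pz : (size pts')%:R = (size pts)%:R + 2 * (size B)%:R :> R.
  by rewrite !size_cat !size_map addnn -mul2n natrD natrM.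
have [||s2 [s2p s2E s2c]] := @bypass_vertices _ _ x0 pts' s1.
- by rewrite mem_cat x0p.
- move=> h h0; rewrite s1E.
  have -> : functional (mu - flow x0 B) h =
    functional mu h - functional (flow x0 B) h by [].
  rewrite mu0 ?functional_flow ?big1_seq ?subrr//.
    move=> b /= bB; rewrite !h0 ?subrr ?mulr0// !mem_cat.
      by rewrite (map_f (fun e : R * (M * M) => e.2.2) bB) !orbT.
    by rewrite (map_f (fun e : R * (M * M) => e.2.1) bB) !orbT.
  by move=> x xp; rewrite h0// mem_cat xp.
have [s3 [s3E s3c s3z]] := sparse_flow x0 s2p.
have muE : mu = flow x0 B + flow x0 s3 by rewrite s3E s2E s1E addrC subrK.
rewrite muE; apply: le_trans (free_norm_triangle _ _ _) _.
have h1 := free_norm_flow x0 p B; have h2 := free_norm_flow x0 p s3.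
have h3 := flow_cost_le_size s3 t0; rewrite -/k in h3.
have h4 : (size s3)%:R * t `^ p <= e + 2 * (size B)%:R * t `^ p.
  apply: le_trans (_ : (size pts')%:R * t `^ p <= _).
    by rewrite ler_wpM2r ?powR_ge0// ler_nat.
  by rewrite pz mulrDl lerD2r.
have h5 : flow_cost 1 s3 * k <= 2 * e.
  rewrite -ler_pdivlMr//; apply: le_trans s3c _; apply: le_trans s2c _.
  exact: ltW.
(* With b the p-cost of [B], the p-cost of [s3] is at most e + 2b + 2e. The total 3b + 3e is at most
   6e because b < e. *)
rewrite -mulrA in h4; lra.
Qed.

End SparseEstimate.

(** * Extension of linear contractions to completions *)

Section CompletionMap.
Variables (R : realType) (p q : exponent R).
Variables (V : pNormedType p) (W : pNormedType q).
Variable f : V -> W.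
Hypotheses (f_linear : linear f) (f_le : forall x, pnorm (f x) <= pnorm x).

Lemma linear_propB (x y : V) : f (x - y) = f x - f y.
Proof. by rewrite -[x - y]addrC -scaleN1r f_linear scaleN1r addrC. Qed.

(** The two metrics are a p-th and a q-th power of a norm, so a tolerance e in the target
    corresponds to e^(p/q) in the source. *)
Lemma pdist_contraction_lt (x y : V) (e : R) : 0 < e ->
  pdist x y < (e `^ (q : R)^-1) `^ p -> pdist (f x) (f y) < e.
Proof.
move=> e0; apply: contraTT; rewrite -!leNgt /pdist -linear_propB => ef.
rewrite ler_powR_expo ?powR_ge0//; apply: le_trans (f_le _).
rewrite -[leRHS](powR_expoK q (pnorm_ge0 _)).
by rewrite ge0_ler_powR ?nnegrE ?invr_ge0 ?expo_ge0 ?powR_ge0// ltW.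
Qed.

Lemma contraction_cauchy (u : cauchySeq V) : f \o u \in @cauchy_pred R q W.
Proof.
apply/asboolP => e e0; have ep : 0 < (e `^ (q : R)^-1) `^ p by rewrite
  !powR_gt0.
have [N hN] := asboolW (cseqP u) _ ep.
by exists N => m n Nm Nn; apply: pdist_contraction_lt => //; exact: hN.
Qed.

Definition cauchy_map u : cauchySeq W := CauchySeq (contraction_cauchy u).

(** A representative is chosen here; [completion_mapE] shows that the choice does not matter. *)
Definition completion_map (x : completion V) : completion W :=
  to_completion (cauchy_map (repr x)).

Lemma to_completion0 (r : exponent R) (X : pNormedType r) :
  to_completion (0 : cauchySeq X) = 0.
Proof. by rewrite -(subrr (0 : cauchySeq X)) to_completionB subrr. Qed.

Lemma to_completion_eq0 (r : exponent R) (X : pNormedType r) (u : cauchySeq X) :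
  to_completion u = 0 <-> p_converges (cseq u) 0.
Proof. by rewrite -to_completion0 to_completionP subr0. Qed.

Lemma completion_mapE u : completion_map (to_completion u) =
  to_completion (cauchy_map u).
Proof.
apply/to_completionP => e e0.
have ep : 0 < (e `^ (q : R)^-1) `^ p by rewrite !powR_gt0.
have /to_completionP/(_ _ ep)[N hN] := to_completion_repr (to_completion u).
exists N => n Nn; rewrite /pdist subr0; apply: pdist_contraction_lt => //.
by have := hN n Nn; rewrite /pdist subr0.
Qed.

Lemma completion_map_linear : linear completion_map.
Proof.
move=> a x y; have [u ->] := completion_surj x;
  have [v ->] := completion_surj y.
rewrite -to_completionZ -to_completionD !completion_mapE -to_completionZ
  -to_completionD.
by congr to_completion; apply/val_inj/funext => n; exact: f_linear.
Qed.

Lemma pnorm_completion_map_le x : pnorm (completion_map x) <= pnorm x.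
Proof.
have [u ->] := completion_surj x; rewrite completion_mapE.
apply/ler_addgt0Pr => e e0; set c := _ + e.
have c0 : 0 < c by rewrite ltr_wpDl// pnorm_ge0.
(* The limit lies strictly below c^p, so the terms of the sequence eventually do too, and their
   images have norm at most c. *)
have uc : limn (fun n => pnorm (u n) `^ p) < c `^ p.
  rewrite -completion_norm_powE; apply: gt0_ltr_powR;
    rewrite ?expo_gt0 ?nnegrE ?(ltW c0)//.
    exact: pnorm_ge0.
  by rewrite ltrDl.
have [N _ hN] := cvgr_lt _ (@cauchy_pnorm _ _ _ u) _ uc.
have h : pdist (to_completion (cauchy_map u)) (to_completion 0) <= c `^ q.
  apply: (@pdist_to_completion_le _ _ _ _ _ _ N) => n Nn.
  rewrite /pdist subr0 ler_powR_expo ?pnorm_ge0//; apply: le_trans (f_le _) _.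
  rewrite leNgt; apply/negP => h; have := hN n Nn; apply/negP; rewrite -leNgt.
  by rewrite ler_powR_expo ?(ltW c0)// ltW.
rewrite leNgt; apply/negP => lt; move: h; apply/negP; rewrite -ltNge.
rewrite to_completion0 /pdist subr0.
by apply: gt0_ltr_powR; rewrite ?expo_gt0 ?nnegrE ?(ltW c0) ?pnorm_ge0.
Qed.

Lemma completion_map_in x : completion_map (completion_in x) =
  completion_in (f x).
Proof. by rewrite completion_mapE; congr to_completion; apply/val_inj. Qed.

Lemma bounded_linear_completion_map : bounded_linear completion_map.
Proof.
split; first exact: completion_map_linear.
by exists 1 => x; rewrite mul1r pnorm_completion_map_le.
Qed.

End CompletionMap.

(** * Uniqueness of bounded linear maps on a completion *)

Lemma bounded_linear_sub (R : realType) (p q : exponent R) (X : pNormedType p)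
    (Y : pNormedType q) (S T : X -> Y) :
  bounded_linear S -> bounded_linear T -> bounded_linear (fun x => S x - T x).
Proof.
move=> [lS [C hC]] [lT [D hD]]; split.
  by move=> a y z; rewrite lS lT scalerBr opprD addrACA.
(* The bounds add up only as q-th powers; absolute values guard against negative C or D. *)
pose E := (`|C| `^ q + `|D| `^ q) `^ (q : R)^-1.
exists E => x; rewrite leNgt; apply/negP => h.
have /(gt0_ltr_powR (expo_gt0 q)) := h; rewrite !nnegrE => /(_ _ _).
have E0 : 0 <= E by exact: powR_ge0.
move=> /(_ (mulr_ge0 E0 (pnorm_ge0 _)) (pnorm_ge0 _)); apply/negP;
  rewrite -leNgt.
rewrite powRM ?pnorm_ge0// powR_expoVK ?addr_ge0 ?powR_ge0// mulrDl.
apply: le_trans (pnorm_triangle _ _) _; rewrite pnormN.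
by rewrite lerD// -powRM ?pnorm_ge0// ler_powR_expo ?pnorm_ge0//;
  [apply: le_trans (hC x) _|apply: le_trans (hD x) _];
  rewrite ler_wpM2r ?pnorm_ge0// ler_norm.
Qed.

(** T takes the same value at x and at x - v for every v from [V], and by density x - v can be made
    arbitrarily small. *)
Lemma bounded_linear_completion_eq0 (R : realType) (p q : exponent R)
    (V : pNormedType p) (Y : pNormedType q) (T : completion V -> Y) :
  bounded_linear T -> (forall v, T (completion_in v) = 0) -> forall x, T x = 0.
Proof.
move=> [lT [C hC]] T0 x; apply/pnorm_eq0/eqP; rewrite eq_le pnorm_ge0 andbT.
pose D := `|C| + 1; have D0 : 0 < D by rewrite ltr_wpDl.
apply/ler_addgt0Pr => e e0; rewrite add0r.
have eD : 0 < (e / D) `^ p by rewrite powR_gt0// divr_gt0.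
have [v hv] := completion_dense x eD.
have -> : T x = T (x - completion_in v).
  by rewrite -[x - _]addrC -scaleN1r lT T0 scaler0 add0r.
apply: le_trans (hC _) _; apply: le_trans (_ : D * pnorm (x - completion_in v)
  <= _).
  by rewrite ler_wpM2r ?pnorm_ge0// (le_trans (ler_norm C))// lerDl.
rewrite mulrC -ler_pdivlMr//.
rewrite leNgt; apply/negP => h; move: hv; apply/negP; rewrite -leNgt.
by rewrite ler_powR_expo ?(ltW h)// divr_ge0// ltW.
Qed.

Lemma bounded_linear_completion_unique (R : realType) (p q : exponent R)
    (V : pNormedType p) (Y : pNormedType q) (S T : completion V -> Y) :
  bounded_linear S -> bounded_linear T ->
  (forall v, S (completion_in v) = T (completion_in v)) -> S = T.
Proof.
move=> bS bT ST; apply/funext => x; apply/eqP; rewrite -subr_eq0; apply/eqP.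
apply: (bounded_linear_completion_eq0 (bounded_linear_sub bS bT)) => v.
by rewrite ST subrr.
Qed.

Lemma linear_free_ext (R : realType) (M : metricType R) (x0 : M) (Y : lmodType
  R)
    (S T : freeVec x0 -> Y) : linear S -> linear T ->
  (forall x, S (free_delta x0 x) = T (free_delta x0 x)) -> S =1 T.
Proof.
move=> lS lT ST mu; have [r ->] := free_deltaP mu; rewrite /lincomb.
have lin0 (U : freeVec x0 -> Y) : linear U -> U 0 = 0.
  by move=> lU; have := lU (-1) 0 0; rewrite scaler0 add0r scaleN1r addNr.
elim: r => [|a r IHr]; first by rewrite big_nil (lin0 S lS) (lin0 T lT).
by rewrite !big_cons lS lT ST IHr.
Qed.

(** * The envelope map: existence, uniqueness, injectivity *)

Section Envelope.
Variables (R : realType) (M : metricType R) (x0 : M) (p : exponent R).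
Local Notation one := (exponent1 R).
Implicit Types mu : freeVec x0.

Lemma flow_cost1_powR_le (s : seq (R * (M * M))) :
  flow_cost 1 s `^ p <= flow_cost p s.
Proof.
rewrite flow_cost1 /flow_cost; elim: s => [|e s IHs].
  by rewrite !big_nil powR0 ?expo_neq0.
rewrite !big_cons; apply: le_trans (powR_subadd p _ _) _.
- by rewrite mulr_ge0// mdist_ge0.
- by rewrite sumr_ge0// => i _; rewrite mulr_ge0// mdist_ge0.
- by rewrite lerD2l.
Qed.

(** By [flow_cost1_powR_le], a representation that is cheap for p is cheap for 1. Hence the identity
    of the span is a contraction, which extends to the envelope map. *)
Lemma free_norm1_le mu : free_norm one mu <= free_norm p mu.
Proof.
rewrite leNgt; apply/negP => h.
have := gt0_ltr_powR (expo_gt0 p).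
move=> /(_ _ _ (free_norm_ge0 p mu) (free_norm_ge0 one mu) h).
move=> /free_norm_flow_exists[s <-]; apply/negP; rewrite -leNgt.
apply: le_trans (flow_cost1_powR_le s).
by rewrite ler_powR_expo ?free_norm_ge0// free_norm1_flow.
Qed.

Let free_pspace_id (mu : free_pspace x0 p) : free_pspace x0 one := mu.

Let free_pspace_id_linear : linear free_pspace_id.
Proof. by []. Qed.

Definition envelope : lipschitz_free x0 p -> lipschitz_free x0 one :=
  completion_map free_pspace_id_linear free_norm1_le.

Lemma envelope_linear : linear envelope.
Proof. exact: completion_map_linear. Qed.

Lemma is_envelope_map_envelope : is_envelope_map envelope.
Proof.
split; first exact: bounded_linear_completion_map.
by move=> x; exact: completion_map_in.
Qed.

(** Linearity carries agreement from the points to their span; boundedness and density carry it to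
    the completion. *)
Lemma is_envelope_map_unique J J' :
  @is_envelope_map R M x0 p J -> @is_envelope_map R M x0 p J' -> J = J'.
Proof.
move=> [bJ dJ] [bJ' dJ']; apply: (bounded_linear_completion_unique bJ bJ').
have in_linear (T : completion (free_pspace x0 p) -> lipschitz_free x0 one) :
    linear T -> linear (fun mu : freeVec x0 => T (completion_in (mu :
      free_pspace x0 p))).
  move=> lT a u v.
  exact: etrans (congr1 T (completion_in_linear a (u : free_pspace x0 p) v))
    (lT _ _ _).
apply: (linear_free_ext (in_linear _ (proj1 bJ)) (in_linear _ (proj1 bJ'))) =>
  x.
exact: etrans (dJ x) (esym (dJ' x)).
Qed.

(** An element of the kernel is represented by a p-Cauchy sequence in the span that is null for
    exponent 1. The sparse estimate shows that it is null for p. *)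
Lemma envelope_injective : injective envelope.
Proof.
have ker0 x : envelope x = 0 -> x = 0.
  have [u ->] := completion_surj x; rewrite /envelope completion_mapE.
  move=> /to_completion_eq0 u0; apply/to_completion_eq0 => e e0.
  (* The estimate returns 6 (e / 7), strictly less than e. *)
  have e1 : 0 < e / 7 by rewrite divr_gt0.
  have [N hN] := asboolW (cseqP u) _ e1; exists N => n Nn.
  have [r hr] := free_deltaP (u n : freeVec x0).
  (* Bypassing vertices needs the base point in the list, which also makes its size nonzero. *)
  pose pts := x0 :: map snd r.
  have z0 : 0 < (size pts)%:R :> R by rewrite ltr0n.
  (* The solution of (size pts) t^p = e / 7. *)
  pose t := (e / 7 / (size pts)%:R) `^ (p : R)^-1.
  have t0 : 0 < t by rewrite powR_gt0// divr_gt0.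
  have k0 : 0 < t `^ ((p : R) - 1) by rewrite powR_gt0.
  (* [N'] depends on n through t, but [N] does not. The term at [maxn N N'] serves only for
     comparison with [u n]. *)
  have [N' hN'] := u0 _ (divr_gt0 e1 k0).
  have := @free_norm_le_sparse R M x0 p pts (u n) (u (maxn N N')) (e / 7) t.
  rewrite /pdist subr0 => h; apply: le_lt_trans (h _ _ _ _ _ _) _.
  - exact: mem_head.
  - move=> f f0; rewrite hr functional_lincomb big1_seq// => a /= ar.
    by rewrite f0 ?mulr0// inE map_f ?orbT.
  - exact: t0.
  - by rewrite /t powR_expoVK ?divr_ge0 ?(ltW e0)// mulrC divfK ?gt_eqF.
  - exact: (hN _ _ Nn (leq_maxl _ _)).
  - have := hN' _ (leq_maxr N N'); rewrite /pdist subr0 /= powRr1 ?pnorm_ge0//.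
    by rewrite ltr_pdivlMr.
  - lra.
move=> x y xy; apply/eqP; rewrite -subr_eq0; apply/eqP/ker0.
by rewrite (linear_propB envelope_linear) xy subrr.
Qed.

End Envelope.

Theorem theorem1 (R : realType) (M : metricType R) (x0 : M)
    (p : R) (p_gt0 : 0 < p) (p_lt1 : p < 1) :
  exists J : lipschitz_free x0 (Exponent p_gt0 (ltW p_lt1)) ->
             lipschitz_free x0 (exponent1 R),
    [/\ is_envelope_map J,
        forall J', is_envelope_map J' -> J' = J
      & injective J].
Proof.
exists (@envelope R M x0 _); split.
- exact: is_envelope_map_envelope.
- by move=> J' hJ'; exact: is_envelope_map_unique hJ' (is_envelope_map_envelope
    _ _).
- exact: envelope_injective.
Qed.
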